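(* Let $F$ be a field whose characteristic is not $2$, let $J$ be a Jordan algebra over $F$ with unit $1$, and let $D:J\to J$ be a triple derivation. Then $D$ is a derivation on $J$. Moreover, $\mathrm{TDer}(J)=\mathrm{Der}(J)$.
   Context: A Jordan algebra over a field $F$ is an $F$-algebra $J$ with product $\circ$ such that $x\circ y = y\circ x$ and $(x^2\circ y)\circ x = x^2\circ(x\circ y)$ for all $x,y\in J$, where $x^2 = x\circ x$. A derivation of $J$ is a linear map $D:J\to J$ with $D(x\circ y) = D(x)\circ y + x\circ D(y)$ for all $x,y\in J$. A triple derivation of $J$ is a linear map $D:J\to J$ with $D((x\circ y)\circ z) = (D(x)\circ y)\circ z + (x\circ D(y))\circ z + (x\circ y)\circ D(z)$ for all $x,y,z\in J$. $\mathrm{Der}(J)$ and $\mathrm{TDer}(J)$ denote the sets of all derivations and of all triple derivations of $J$, respectively. *)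

(* Defs.v *)
From mathcomp Require Import all_boot all_order all_algebra.
From mathcomp Require Import boolp classical_sets.

Set Implicit Arguments.
Unset Strict Implicit.
Unset Printing Implicit Defensive.

Import GRing.Theory.
Local Open Scope ring_scope.
Local Open Scope classical_set_scope.

(* MathComp has no non-associative algebras: an F-algebra is an F-module J,
   of arbitrary dimension, with its product given as a bilinear map. *)
Section Jordan.
Variables (F : fieldType) (J : lmodType F) (mul : {bilinear J -> J -> J}).

Local Notation "x ∘ y" := (mul x y) (at level 40, left associativity).

Definition jordan_algebra : Prop :=
  (forall x y : J, x ∘ y = y ∘ x) /\
  (forall x y : J, ((x ∘ x) ∘ y) ∘ x = (x ∘ x) ∘ (x ∘ y)).

Definition is_unit (e : J) : Prop :=
  forall x : J, e ∘ x = x /\ x ∘ e = x.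

Definition derivation (D : {linear J -> J}) : Prop :=
  forall x y : J, D (x ∘ y) = D x ∘ y + x ∘ D y.

Definition triple_derivation (D : {linear J -> J}) : Prop :=
  forall x y z : J,
    D ((x ∘ y) ∘ z) = (D x ∘ y) ∘ z + (x ∘ D y) ∘ z + (x ∘ y) ∘ D z.

Definition Der : set {linear J -> J} := [set D | derivation D].

Definition TDer : set {linear J -> J} := [set D | triple_derivation D].

End Jordan.

(* Main.v *)
(** Putting x = y = z = 1 in the triple Leibniz rule gives D 1 = 3 D 1, so D 1 = 0
    as 2 is invertible; putting z = 1 then gives the Leibniz rule. *)
Require Import Defs.
From mathcomp Require Import all_boot all_order all_algebra.
From mathcomp Require Import boolp classical_sets.

Set Implicit Arguments.
Unset Strict Implicit.
Unset Printing Implicit Defensive.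

Import GRing.Theory.
Local Open Scope ring_scope.

(** The unit turns the ternary rule into the binary one as soon as [D e = 0], which is
    [triple_derivation_unit]. The reverse inclusion, [derivation_triple_derivation], is the Leibniz
    rule applied to the outer product and then to the inner one. *)

Lemma triple_derivation_unit (F : fieldType) (charF : 2%N \notin [pchar F])
    (J : lmodType F) (mul : {bilinear J -> J -> J}) (e : J)
    (unit_e : is_unit mul e) (D : {linear J -> J}) :
  triple_derivation mul D -> D e = 0.
Proof.
move=> tD; have := tD e e e.
have mule x : mul x e = x by case: (unit_e x).
have emul x : mul e x = x by case: (unit_e x).
rewrite !(mule, emul) -addrA -[LHS]addr0 => /addrI /esym.
(* The remaining [D e + D e = 0] is read as scaling by the element 2 of [F], so that either 2 or
   [D e] vanishes. *)
rewrite -mulr2n -scaler_nat => /eqP.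
rewrite scaler_eq0 => /orP[/eqP two0 | /eqP //].
(* As 2 is prime, [2 = 0] in [F] would make 2 the characteristic. *)
by case/negP: charF; rewrite inE /= two0.
Qed.

Lemma triple_derivation_derivation (F : fieldType)
    (charF : 2%N \notin [pchar F]) (J : lmodType F)
    (mul : {bilinear J -> J -> J}) (e : J) (unit_e : is_unit mul e)
    (D : {linear J -> J}) :
  triple_derivation mul D -> derivation mul D.
Proof.
move=> tD x y; have := tD x y e.
have mule z : mul z e = z by case: (unit_e z).
by rewrite (triple_derivation_unit charF unit_e tD) linear0r addr0 !mule.
Qed.

Lemma derivation_triple_derivation (F : fieldType) (J : lmodType F)
    (mul : {bilinear J -> J -> J}) (D : {linear J -> J}) :
  derivation mul D -> triple_derivation mul D.
Proof. by move=> dD x y z; rewrite !dD linearDl. Qed.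

Theorem theorem3p4 (F : fieldType) (charF : 2%N \notin [pchar F])
    (J : lmodType F) (mul : {bilinear J -> J -> J})
    (jordanJ : jordan_algebra mul) (e : J) (unit_e : is_unit mul e) :
  (forall D : {linear J -> J}, triple_derivation mul D -> derivation mul D) /\
  TDer mul = Der mul.
Proof.
have tder_der := triple_derivation_derivation charF unit_e.
split; first exact: tder_der.
apply/seteqP; split=> D /=; first exact: tder_der.
exact: derivation_triple_derivation.
Qed.
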